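(* Let $r,J,K$ be positive integers and let $c_{js},d_{ks}\in\mathbb{Z}_{\ge 0}$ for $1\le j\le J$, $1\le k\le K$, $1\le s\le r$. Put $C_j(x)=\sum_{s=1}^r c_{js}x_s$ and $D_k(x)=\sum_{s=1}^r d_{ks}x_s$ for $x=(x_1,\dots,x_r)$. Assume: no $C_j$ and no $D_k$ is identically zero; $C_j\neq D_k$ for all $j,k$; for each $s$ some $c_{js}\neq 0$ or some $d_{ks}\neq 0$; and $\sum_{j=1}^J c_{js}=\sum_{k=1}^K d_{ks}$ for $s=1,\dots,r$. Define $\Phi(x)=\sum_{j=1}^J\lfloor C_j(x)\rfloor-\sum_{k=1}^K\lfloor D_k(x)\rfloor$ and $\mathcal{D}=\{x\in[0,1)^r : C_j(x)\ge 1 \text{ for some } j \text{ or } D_k(x)\ge 1\text{ for some }k\}$. Let $n=r+J+K$, $N=n+r$, let $\mathbf{a}_1,\dots,\mathbf{a}_n$ be the standard unit basis vectors of $\mathbb{R}^n$, and for $s=1,\dots,r$ let $\mathbf{a}_{n+s}=(e_s,c_{1s},\dots,c_{Js},-d_{1s},\dots,-d_{Ks})\in\mathbb{Z}^n$, where $e_s\in\mathbb{R}^r$ is the $s$-th standard unit vector. Let $A=\{\mathbf{a}_1,\dots,\mathbf{a}_N\}$ and let $\Delta(A)$ be the convex hull of $A\cup\{\mathbf{0}\}$; for $z\ge 0$ let $z\Delta(A)=\{zu: u\in\Delta(A)\}$. Then: (a) $\Phi(x)\ge 0$ for all $x\in[0,1)^r$ if and only if $(J+r)\Delta(A)$ contains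 no interior lattice points (points of $\mathbb{Z}^n$ in its interior). (b) $\Phi(x)\ge 1$ for all $x\in\mathcal{D}$ if and only if $\sum_{i=1}^{J+r}\mathbf{a}_i$ is the unique interior lattice point of $(J+r+1)\Delta(A)$.
   Context: $\lfloor\cdot\rfloor$ denotes the floor function. ''Interior'' means the topological interior in $\mathbb{R}^n$. *)

(* Defs.v *)
From mathcomp Require Import all_boot all_order all_algebra.
From mathcomp Require Import all_classical all_reals all_analysis.

Set Implicit Arguments.
Unset Strict Implicit.
Unset Printing Implicit Defensive.

Import Order.TTheory GRing.Theory Num.Theory.
Import numFieldNormedType.Exports.

Local Open Scope classical_set_scope.
Local Open Scope ring_scope.

Definition convex_hull (R : numDomainType) (V : lmodType R) (S : set V) : set V :=
  smallest (fun B : set (convex_lmodType V) => convex_set B) S.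

Definition dilate (R : numDomainType) (V : lmodType R) (z : R) (S : set V) :
    set V :=
  [set z *: u | u in S].

Definition interior_lattice_points (R : realType) (n : nat) (S : set 'rV[R]_n) :
    set 'rV[R]_n :=
  [set v | S° v /\ forall i, v 0 i \is a Num.int].

Definition linear_form (R : realType) (r : nat) (a : 'I_r -> nat)
    (x : 'rV[R]_r) : R :=
  \sum_(s < r) (a s)%:R * x 0 s.

Definition half_open_cube (R : realType) (r : nat) : set 'rV[R]_r :=
  [set x | forall s, 0 <= x 0 s < 1].

Section Data.
Variables (R : realType) (r J K : nat).
Variables (c : 'I_J -> 'I_r -> nat) (d : 'I_K -> 'I_r -> nat).

Definition Phi (x : 'rV[R]_r) : int :=
  \sum_(j < J) Num.floor (linear_form (c j) x)
  - \sum_(k < K) Num.floor (linear_form (d k) x).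

Definition calD : set 'rV[R]_r :=
  [set x | half_open_cube x /\
     ((exists j, 1 <= linear_form (c j) x)
      \/ (exists k, 1 <= linear_form (d k) x))].

Definition avec_special (s : 'I_r) : 'rV[R]_(r + J + K) :=
  row_mx (row_mx (delta_mx 0 s) (\row_j (c j s)%:R)) (\row_k - (d k s)%:R).

Definition avec (i : 'I_((r + J + K) + r)) : 'rV[R]_(r + J + K) :=
  match fintype.split i with
  | inl l => delta_mx 0 l
  | inr s => avec_special s
  end.

Definition DeltaA : set 'rV[R]_(r + J + K) := convex_hull (range avec `|` [set 0]).

End Data.

Arguments Phi {R r J K} c d x.
Arguments calD R {r J K} c d.
Arguments avec R {r J K} c d i.
Arguments DeltaA R {r J K} c d.

(* Main.v *)
Require Import Defs.
From mathcomp Require Import all_boot all_order all_algebra.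
From mathcomp Require Import all_classical all_reals all_analysis.
From mathcomp Require Import ring lra zify.

Set Implicit Arguments.
Unset Strict Implicit.
Unset Printing Implicit Defensive.

Import Order.TTheory GRing.Theory Num.Theory.
Import numFieldNormedType.Exports.

Local Open Scope classical_set_scope.
Local Open Scope ring_scope.

(** Put [L y = \sum_s y_s a_(n+s)], whose coordinates are [y], the [C_j y] and
    the [- D_k y].  All the [a_i] have coordinate sum [1], so [z Delta(A)] is
    the set of the [v] of coordinate sum at most [z] with [L y <= v] for some
    [y >= 0], and its interior is given by the strict versions of these
    inequalities.  A lattice point [v > L y] has coordinates at least
    [floor (L y) + 1]; as [floor (- D) >= - floor D - 1], its coordinate sum
    is at least [J + r + \sum_s floor y_s + Phi y], and [Phi] is invariant
    under integer translations.  Conversely the point with coordinates [1],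
    [floor (C_j x) + 1], [- floor (D_k x)] has coordinate sum [J + r + Phi x],
    and it exceeds [L y] for [y] slightly larger than [x]. *)

(** * Small positive perturbations: floors and interior points *)

Lemma near_right0_ltD (R : realType) (a b c : R) :
  b < a -> \forall e \near 0^'+, b + e * c < a.
Proof.
move=> ba; apply: (@cvgr_lt _ _ _ _ (fun e => b + e * c) b) => //.
rewrite -[X in _ --> X]addr0 -[X in b + X](mul0r c).
apply: cvgD; first exact: cvg_cst.
by apply: cvgMr_tmp; apply: cvg_at_right_filter; exact: cvg_id.
Qed.

Lemma near_right0_floorD (R : realType) (b c : R) : 0 <= c ->
  \forall e \near 0^'+, Num.floor (b + e * c) = Num.floor b.
Proof.
move=> c0; near=> e; apply: floor_def; apply/andP; split.
  by rewrite (le_trans (floor_le b))// lerDl mulr_ge0.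
by near: e; apply: near_right0_ltD; exact: floorD1_gt.
Unshelve. all: by end_near. Qed.

Lemma near_right0_floorND (R : realType) (b c : R) : 0 < c ->
  \forall e \near 0^'+, Num.floor (- (b + e * c)) = - Num.floor b - 1.
Proof.
move=> c0; near=> e; apply: floor_def; apply/andP; split.
  rewrite -opprD intrN lerN2 ltW//.
  by near: e; apply: near_right0_ltD; exact: floorD1_gt.
by rewrite subrK intrN ltrN2 (le_lt_trans (floor_le b))// ltrDl mulr_gt0.
Unshelve. all: by end_near. Qed.

(** Holds because [v + e *: w] tends to [v]. With a suitable direction [w], weak inequalities at the
    shifted point become strict ones at [v]. *)
Lemma interior_ray (R : realType) (n : nat) (S : set 'rV[R]_n)
    (v w : 'rV[R]_n) : S° v -> exists2 e : R, 0 < e & S (v + e *: w).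
Proof.
move=> Sv.
have : \forall e \near (0:R)^'+, S (v + e *: w).
  suff : (v + e *: w) @[e --> (0:R)^'+] --> v by apply.
  rewrite -[X in _ --> X]addr0 -[X in v + X](scale0r w).
  apply: cvgD; first exact: cvg_cst.
  by apply: cvgZr_tmp; apply: cvg_at_right_filter; exact: cvg_id.
move=> Sn; near (0:R)^'+ => e; exists e => //.
by near: e.
Unshelve. all: by end_near. Qed.

(** * Convexity *)

Lemma convex_setP (R : numDomainType) (V : lmodType R) (B : set V) :
  @convex_set R V B <-> forall (x y : V) (p : R), 0 <= p <= 1 ->
    B x -> B y -> B (p *: x + (1 - p) *: y).
Proof.
split=> [cB x y p /andP[p0 p1] Bx By|cB x y p /set_mem Bx /set_mem By].
  exact/set_mem/(cB x y (Itv01 p0 p1) (mem_set Bx) (mem_set By)).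
apply/mem_set/(cB x y p%:num) => //.
by rewrite (ge0 p) (le1 p).
Qed.

(** The weight missing from a total of [1] is carried by the point [0] of [B]. *)
Lemma convex_set_sub1_comb (R : numFieldType) (V : lmodType R)
    (B : set V) (I : Type) (s : seq I) (t : I -> R)
    (a : I -> V) :
  @convex_set R V B -> B 0 -> (forall i, B (a i)) -> (forall i, 0 <= t i) ->
  \sum_(i <- s) t i <= 1 -> B (\sum_(i <- s) t i *: a i).
Proof.
move=> /convex_setP conv2 B0 Ba t0.
(* The bound [1] is generalized to any [m], because peeling off the term [i] leaves the bound
   [m - t i] for the rest. *)
suff comb (m : R) : \sum_(i <- s) t i <= m ->
    exists2 b, B b & \sum_(i <- s) t i *: a i = m *: b.
  by move=> /comb[b Bb ->]; rewrite scale1r.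
elim: s m => [|i s IH] m; first by rewrite !big_nil; exists 0; rewrite ?scaler0.
rewrite !big_cons => tm.
have rest_ge0 : 0 <= \sum_(j <- s) t j by apply: sumr_ge0.
have tim : t i <= m by rewrite (le_trans _ tm)// lerDl.
have m0 : 0 <= m by rewrite (le_trans _ tim).
have [|b Bb ->] := IH (m - t i); first by rewrite lerBrDl.
have [m_eq0|m_neq0] := eqVneq m 0.
  have ti0 : t i = 0 by apply/eqP; rewrite eq_le t0 andbT -m_eq0.
  by exists 0; rewrite // ti0 m_eq0 subrr !scale0r addr0.
exists (t i / m *: a i + (1 - t i / m) *: b).
  apply: conv2 => //; rewrite divr_ge0//= ler_pdivrMr ?mul1r//.
  by rewrite lt_neqAle eq_sym m_neq0.
by rewrite scalerDr !scalerA mulrBr mulr1 mulrC divfK.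
Qed.

(** * Coordinate sums and combinations of the special vectors *)

Section Polytope.
Variables (R : realType) (r J K : nat).
Variables (c : 'I_J -> 'I_r -> nat) (d : 'I_K -> 'I_r -> nat).
Hypothesis cd_sum : forall s, (\sum_(j < J) c j s = \sum_(k < K) d k s)%N.

Implicit Types (x y : 'rV[R]_r) (v : 'rV[R]_(r + J + K)).

(** The linear functional equal to [1] on every [avec], once [cd_sum] is assumed. *)
Definition height v : R := \sum_i v 0 i.

Definition special_comb y : 'rV[R]_(r + J + K) :=
  \sum_s y 0 s *: avec_special R c d s.

Lemma heightD v w : height (v + w) = height v + height w.
Proof. by rewrite -big_split; apply: eq_bigr => i _; rewrite mxE. Qed.

Lemma heightZ a v : height (a *: v) = a * height v.
Proof. by rewrite /height mulr_sumr; apply: eq_bigr => i _; rewrite mxE. Qed.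

Lemma height_delta i : height (delta_mx 0 i) = 1.
Proof.
rewrite /height (bigD1 i)//= big1 => [|j ji]; first by rewrite mxE !eqxx addr0.
by rewrite mxE (negPf ji) andbF.
Qed.

Lemma special_combD x y : special_comb (x + y) = special_comb x + special_comb y.
Proof. by rewrite -big_split; apply: eq_bigr => i _; rewrite mxE scalerDl. Qed.

Lemma special_combZ a y : special_comb (a *: y) = a *: special_comb y.
Proof.
by rewrite scaler_sumr; apply: eq_bigr => i _; rewrite mxE scalerA.
Qed.

Lemma special_comb_delta s : special_comb (delta_mx 0 s) = avec_special R c d s.
Proof.
rewrite /special_comb (bigD1 s)//= big1 => [|j ji].
  by rewrite mxE !eqxx scale1r addr0.
by rewrite mxE (negPf ji) andbF scale0r.
Qed.

Lemma special_comb_lshift y s :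
  special_comb y 0 (lshift K (lshift J s)) = y 0 s.
Proof.
rewrite summxE (bigD1 s)//= big1 => [|t ts].
  by rewrite mxE !row_mxEl mxE !eqxx mulr1 addr0.
by rewrite mxE !row_mxEl mxE eq_sym (negPf ts) andbF mulr0.
Qed.

Lemma special_comb_mid y j :
  special_comb y 0 (lshift K (rshift r j)) = linear_form (c j) y.
Proof.
rewrite summxE; apply: eq_bigr => s _.
by rewrite mxE row_mxEl row_mxEr mxE mulrC.
Qed.

Lemma special_comb_rshift y k :
  special_comb y 0 (rshift (r + J) k) = - linear_form (d k) y.
Proof.
rewrite summxE -sumrN; apply: eq_bigr => s _.
by rewrite mxE row_mxEr mxE mulrN mulrC.
Qed.

(** By [cd_sum], the coefficients of each [y_s] in the forms [C_j] and [- D_k] cancel, so only the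
    first block contributes. *)
Lemma height_special_comb y : height (special_comb y) = \sum_s y 0 s.
Proof.
rewrite /height !big_split_ord/=.
under eq_bigr do rewrite special_comb_lshift.
under [X in _ + X + _]eq_bigr do rewrite special_comb_mid.
under [X in _ + X = _]eq_bigr do rewrite special_comb_rshift.
rewrite sumrN /linear_form exchange_big/= [X in _ - X]exchange_big/=.
rewrite -addrA -sumrB [X in _ + X]big1 ?addr0// => s _.
by rewrite -!mulr_suml -!natr_sum cd_sum subrr.
Qed.

(** * Inequalities for the dilated polytope and its interior *)

Lemma sum_avec (t : 'I_(r + J + K + r) -> R) :
  \sum_i t i *: avec R c d i =
  (\row_i t (lshift r i)) + special_comb (\row_s t (rshift (r + J + K) s)).
Proof.
rewrite big_split_ord/=; congr (_ + _).
  rewrite [RHS]row_sum_delta; apply: eq_bigr => i _.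
  by rewrite mxE /avec (unsplitK (inl _)).
by apply: eq_bigr => s _; rewrite mxE /avec (unsplitK (inr _)).
Qed.

(** Here [y] holds the weights of the special vectors and the slack [v - special_comb y] those of
    the unit vectors. Their total is [height v], and [0] takes the rest. *)
Lemma DeltaAE : DeltaA R c d =
  [set v : 'rV[R]_(r + J + K) | exists y, [/\ forall s, 0 <= y 0 s,
    forall i, special_comb y 0 i <= v 0 i & height v <= 1]].
Proof.
apply/seteqP; split.
  apply: smallest_sub.
    apply/convex_setP => v w q /andP[q0 q1] [y [y0 yv hv]] [x [x0 xw hw]].
    rewrite -subr_ge0 in q1.
    exists (q *: y + (1 - q) *: x); split => [s|i|].
    - by rewrite !mxE addr_ge0// mulr_ge0.
    - by rewrite special_combD !special_combZ !mxE lerD// ler_wpM2l.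
    - rewrite heightD !heightZ -[leRHS](subrKC q).
      by rewrite lerD// ler_piMr.
  move=> v [[i _ <-{v}]|->]; last first.
    exists 0; split => [s|i|]; rewrite ?mxE//.
      by rewrite -[X in special_comb X](scale0r 0) special_combZ scale0r mxE.
    by rewrite /height big1// => i _; rewrite mxE.
  rewrite /avec; case: (fintype.split i) => [l|s].
    exists 0; split => [s|i'|]; rewrite ?mxE ?height_delta//.
    by rewrite -[X in special_comb X](scale0r 0) special_combZ scale0r mxE ler0n.
  exists (delta_mx 0 s); split => [t|i'|]; first by rewrite mxE ler0n.
    by rewrite special_comb_delta.
  rewrite -special_comb_delta height_special_comb (bigD1 s)//= big1 ?mxE ?eqxx ?addr0//.
  by move=> t ts; rewrite mxE (negPf ts).
move=> v [y [y0 yv hv]] B [cB AB].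
pose t i := row_mx (v - special_comb y) y 0 i.
have tl l : t (lshift r l) = v 0 l - special_comb y 0 l.
  by rewrite /t row_mxEl !mxE.
have tr s : t (rshift (r + J + K) s) = y 0 s by rewrite /t row_mxEr.
have tE : \sum_i t i *: avec R c d i = v.
  rewrite sum_avec; under eq_mx do rewrite tl.
  have -> : \row_s t (rshift (r + J + K) s) = y.
    by apply/rowP => s; rewrite mxE tr.
  by apply/rowP => i; rewrite !mxE subrK.
rewrite -tE; apply: convex_set_sub1_comb => //.
- by apply: AB; right.
- by move=> i; apply: AB; left; exists i.
- by move=> i; case: (split_ordP i) => l ->; rewrite ?tl ?tr// subr_ge0.
- rewrite big_split_ord/=; under eq_bigr do rewrite tl.
  under [X in _ + X]eq_bigr do rewrite tr.
  by rewrite sumrB -height_special_comb subrK.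
Qed.

Lemma dilate_DeltaAE (z : R) : 0 < z -> dilate z (DeltaA R c d) =
  [set v : 'rV[R]_(r + J + K) | exists y, [/\ forall s, 0 <= y 0 s,
    forall i, special_comb y 0 i <= v 0 i & height v <= z]].
Proof.
move=> z0; rewrite DeltaAE; apply/seteqP; split.
  move=> _ [v [y [y0 yv hv]] <-]; exists (z *: y); split => [s|i|].
  - by rewrite mxE mulr_ge0// ltW.
  - by rewrite special_combZ !mxE ler_pM2l.
  - by rewrite heightZ ger_pMr.
move=> v [y [y0 yv hv]]; exists (z^-1 *: v); last first.
  by rewrite scalerA divff ?gt_eqF// scale1r.
have zV0 : 0 < z^-1 by rewrite invr_gt0.
exists (z^-1 *: y); split => [s|i|].
- by rewrite mxE mulr_ge0// ltW.
- by rewrite special_combZ !mxE ler_pM2l.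
- by rewrite heightZ mulrC ler_pdivrMr// mul1r.
Qed.

Lemma height_continuous : continuous (height : 'rV[R]_(r + J + K) -> R).
Proof.
apply: continuous_big => [|i _]; first exact: add_continuous.
exact: coord_continuous.
Qed.

Lemma interior_dilate_DeltaA (z : R) v : (0 < r + J + K)%N -> 0 < z ->
  (dilate z (DeltaA R c d))° v <->
  exists y, [/\ forall s, 0 < y 0 s,
    forall i, special_comb y 0 i < v 0 i & height v < z].
Proof.
move=> n0 z0; rewrite dilate_DeltaAE//; split => [Dv|[y [y0 yv hv]]].
  have hv : height v < z.
    (* Moving along the all-ones vector raises the height, since the dimension is positive; hence
       the height of [v] itself is strictly below [z]. *)
    have [e e0 [_ [_ _]]] := interior_ray (const_mx 1) Dv.
    apply: lt_le_trans; rewrite heightD heightZ ltrDl mulr_gt0//.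
    rewrite /height; under eq_bigr do rewrite mxE.
    by rewrite sumr_const card_ord ltr0n.
  (* The direction leaves room for two things: [y] can be raised by [e] in each coordinate, making
     it positive, and a gap [e] remains in each inequality. *)
  have [e e0 [y [y0 yv _]]] :=
    interior_ray (- (const_mx 1 + special_comb (const_mx 1))) Dv.
  exists (y + e *: const_mx 1); split => // [s|i].
    by rewrite !mxE mulr1 ltr_wpDl.
  move: (yv i); rewrite special_combD special_combZ !mxE; lra.
(* With [y] fixed, these are finitely many open conditions on [w]. *)
have Lv i : \forall w \near v, special_comb y 0 i < (w : 'rV[R]_(r + J + K)) 0 i.
  exact: (coord_continuous (lt_nbhsr (yv i))).
have hN : \forall w \near v, height w < z.
  exact: (height_continuous (lt_nbhsl hv)).
rewrite /interior/=; near=> w; exists y; split => [s|i|].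
- exact: ltW.
- by apply: ltW; move: i; near: w; exact: filter_forall.
- by apply: ltW; near: w.
Unshelve. all: by end_near. Qed.

(** * Floors and lower bounds for the heights of lattice points *)

Definition floor_height y : int := \sum_i Num.floor (special_comb y 0 i).

Lemma floor_heightE y : floor_height y = \sum_s Num.floor (y 0 s)
  + \sum_j Num.floor (linear_form (c j) y)
  + \sum_k Num.floor (- linear_form (d k) y).
Proof.
rewrite /floor_height !big_split_ord/=; congr (_ + _ + _).
- by apply: eq_bigr => s _; rewrite special_comb_lshift.
- by apply: eq_bigr => j _; rewrite special_comb_mid.
- by apply: eq_bigr => k _; rewrite special_comb_rshift.
Qed.

Lemma floor_height_le v y : (forall i, v 0 i \is a Num.int) ->
  (forall i, special_comb y 0 i < v 0 i) ->
  (floor_height y + (r + J + K)%:Z)%:~R <= height v.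
Proof.
move=> vZ yv.
have -> : (r + J + K)%:Z = \sum_(i < r + J + K) 1.
  by rewrite sumr_const card_ord natz.
rewrite -big_split/= rmorph_sum/=; apply: ler_sum => i _.
have /intrP[m vm] := vZ i.
by rewrite vm ler_int lezD1 floor_lt_int -vm.
Qed.

Lemma floor_linear_formDz n (a : 'I_n -> nat) (x : 'rV[R]_n) (m : 'I_n -> int) :
  Num.floor (linear_form a (x + \row_s (m s)%:~R)) =
  Num.floor (linear_form a x) + \sum_s (a s)%:R * m s.
Proof.
have -> : linear_form a (x + \row_s (m s)%:~R) =
    linear_form a x + (\sum_s (a s)%:R * m s)%:~R.
  rewrite rmorph_sum/= -big_split; apply: eq_bigr => s _ /=.
  by rewrite !mxE mulrDr intrM rmorph_nat.
by rewrite floorDrz ?intr_int// intrKfloor.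
Qed.

(** Each floor moves by an integer combination of the [m s], and by [cd_sum] these shifts cancel. *)
Lemma PhiDz x (m : 'I_r -> int) :
  Phi c d (x + \row_s (m s)%:~R) = Phi c d x.
Proof.
rewrite /Phi; under eq_bigr do rewrite floor_linear_formDz.
under [X in _ - X]eq_bigr do rewrite floor_linear_formDz.
rewrite !big_split/= [X in _ + X - _]exchange_big [X in _ - (_ + X)]exchange_big/=.
rewrite opprD addrACA -sumrB [X in _ + X]big1 ?addr0// => s _.
by rewrite -!mulr_suml -!natr_sum cd_sum subrr.
Qed.

Lemma Phi_floor_height y :
  \sum_s Num.floor (y 0 s) + Phi c d y - K%:Z <= floor_height y.
Proof.
rewrite floor_heightE /Phi -!addrA lerD2l lerD2l.
have -> : - K%:Z = \sum_(k < K) (-1).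
  by rewrite sumr_const card_ord mulNrn natz.
rewrite -sumrN -big_split/=; apply: ler_sum => k _.
rewrite floor_ge_int -opprD intrN lerN2; exact/ltW/floorD1_gt.
Qed.

Lemma height_ge_Phi v y : (forall i, v 0 i \is a Num.int) ->
  (forall i, special_comb y 0 i < v 0 i) ->
  (\sum_s Num.floor (y 0 s) + Phi c d y + (J + r)%:Z)%:~R <= height v.
Proof.
move=> vZ yv; apply: le_trans (floor_height_le vZ yv).
(* The [K] lost in rounding the [- D_k] cancels against the [K] in the dimension. *)
rewrite ler_int; have := Phi_floor_height y; lia.
Qed.

(** Together with [PhiDz], this carries bounds on [Phi] from the cube to every [y]. *)
Lemma frac_half_open_cube y :
  half_open_cube (y + \row_s (- Num.floor (y 0 s))%:~R).
Proof.
move=> s; rewrite !mxE intrN subr_ge0 floor_le/= ltrBlDr addrC.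
by rewrite -[X in _ < _ + X]/(1%:~R) -intrD floorD1_gt.
Qed.

Lemma linear_form_const1 n (a : 'I_n -> nat) :
  linear_form a (const_mx 1 : 'rV[R]_n) = (\sum_s a s)%:R.
Proof. by rewrite natr_sum; apply: eq_bigr => s _; rewrite mxE mulr1. Qed.

Lemma linear_form_ge0 n (a : 'I_n -> nat) (x : 'rV[R]_n) :
  (forall s, 0 <= x 0 s) -> 0 <= linear_form a x.
Proof. by move=> x0; apply: sumr_ge0 => s _; rewrite mulr_ge0. Qed.

(** On this part of the cube every form takes values in [[0, 1)], so all floors vanish. *)
Lemma Phi_eq0 x : half_open_cube x -> ~ calD R c d x -> Phi c d x = 0.
Proof.
move=> x01 xD.
have x0 s : 0 <= x 0 s by case/andP: (x01 s).
rewrite /Phi !big1 ?subr0// => [k|j] _; apply/eqP;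
  rewrite floor_eq linear_form_ge0//= ltNge; apply/negP => le1;
  apply: xD; split => //.
  by right; exists k.
by left; exists j.
Qed.

(** * The lattice point attached to a point of the cube *)

Lemma linear_formD n (a : 'I_n -> nat) (x y : 'rV[R]_n) (e : R) :
  linear_form a (x + e *: y) = linear_form a x + e * linear_form a y.
Proof.
rewrite /linear_form mulr_sumr -big_split; apply: eq_bigr => s _ /=.
by rewrite !mxE; ring.
Qed.

(** For [x] in the cube and [y] slightly larger, each entry is one more than the floor of the
    matching entry of [special_comb y]. The last block shows no [+ 1] because there the floor is
    [- floor (D_k x) - 1]. *)
Definition floor_point x : 'rV[R]_(r + J + K) :=
  row_mx (row_mx (const_mx 1)
    (\row_j (Num.floor (linear_form (c j) x) + 1)%:~R))
    (\row_k (- Num.floor (linear_form (d k) x))%:~R).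

Lemma linear_form0 n (a : 'I_n -> nat) : linear_form a (0 : 'rV[R]_n) = 0.
Proof. by apply: big1 => s _; rewrite mxE mulr0. Qed.

Lemma Phi0 : Phi c d (0 : 'rV[R]_r) = 0.
Proof. by rewrite /Phi !big1 ?subr0// => i _; rewrite linear_form0 floor0. Qed.

(** With [sum_avec_lt], this makes the lattice point of (b) the one attached to [x = 0]. *)
Lemma floor_point0 : floor_point 0 = row_mx (const_mx 1) 0.
Proof.
congr row_mx; last by apply/rowP => k; rewrite !mxE linear_form0 floor0 oppr0.
apply/rowP => i; case: (split_ordP i) => [s ->|j ->].
  by rewrite row_mxEl !mxE.
by rewrite row_mxEr !mxE linear_form0 floor0 add0r.
Qed.

Hypothesis D_gt0 : forall k, 0 < linear_form (d k) (const_mx 1 : 'rV[R]_r).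

(* The translate [x + e (1, ..., 1)], with [e > 0] small, raises no floor of a
   [C_j], but pushes every [D_k] strictly past its integer part. *)
Lemma perturb x : (forall s, 0 <= x 0 s) -> exists y, [/\
  forall s, 0 < y 0 s,
  forall s, Num.floor (y 0 s) = Num.floor (x 0 s),
  forall j, Num.floor (linear_form (c j) y) = Num.floor (linear_form (c j) x)
  & forall k, Num.floor (- linear_form (d k) y) =
              - Num.floor (linear_form (d k) x) - 1].
Proof.
move=> x0.
have nX : \forall e \near 0^'+, forall s,
    Num.floor (x 0 s + e * 1) = Num.floor (x 0 s).
  by apply: filter_forall => s; exact: near_right0_floorD.
have nC : \forall e \near 0^'+, forall j,
    Num.floor (linear_form (c j) x + e * linear_form (c j) (const_mx 1)) =
    Num.floor (linear_form (c j) x).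
  apply: filter_forall => j; apply: near_right0_floorD.
  by rewrite linear_form_const1.
have nD : \forall e \near 0^'+, forall k,
    Num.floor (- (linear_form (d k) x + e * linear_form (d k) (const_mx 1))) =
    - Num.floor (linear_form (d k) x) - 1.
  by apply: filter_forall => k; exact: near_right0_floorND.
near (0 : R)^'+ => e.
exists (x + e *: const_mx 1); split => [s|s|j|k].
- by rewrite !mxE mulr1 ltr_wpDl.
- by rewrite !mxE; move: s; near: e.
- by rewrite linear_formD; move: j; near: e.
- by rewrite linear_formD; move: k; near: e.
Unshelve. all: by end_near. Qed.

(** No dilation factor appears: by [interior_dilate_DeltaA], the point is interior to the dilate by
    any positive [z] exceeding its height. *)
Lemma floor_point_interior x (v := floor_point x) : half_open_cube x ->
  [/\ forall i, v 0 i \is a Num.int,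
      height v = (Phi c d x + (J + r)%:Z)%:~R
    & exists2 y : 'rV[R]_r, forall s, 0 < y 0 s
      & forall i, special_comb y 0 i < v 0 i].
Proof.
move=> x01.
have vx s : v 0 (lshift K (lshift J s)) = 1 by rewrite !row_mxEl mxE.
have vc j : v 0 (lshift K (rshift r j)) =
    (Num.floor (linear_form (c j) x) + 1)%:~R.
  by rewrite row_mxEl row_mxEr mxE.
have vd k : v 0 (rshift (r + J) k) = (- Num.floor (linear_form (d k) x))%:~R.
  by rewrite row_mxEr mxE.
split.
- move=> i; case: (split_ordP i) => [i' ->|k ->]; last by rewrite vd intr_int.
  by case: (split_ordP i') => [s ->|j ->]; rewrite ?vx ?vc// intr_int.
- rewrite /height !big_split_ord/=; under eq_bigr do rewrite vx.
  under [X in _ + X + _]eq_bigr do rewrite vc.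
  under [X in _ + X = _]eq_bigr do rewrite vd.
  rewrite -!rmorph_sum/= big_split/= !sumr_const !card_ord sumrN /Phi.
  by rewrite PoszD !intrD -!pmulrn; ring.
- have [s|y [y0 yx yc yd]] := @perturb x; first by case/andP: (x01 s).
  exists y => // i; case: (split_ordP i) => [i' ->|k ->].
    case: (split_ordP i') => [s ->|j ->].
      rewrite special_comb_lshift vx -[1]/(1%:~R) -floor_lt_int yx floor_lt_int.
      by case/andP: (x01 s).
    by rewrite special_comb_mid vc -yc; exact: floorD1_gt.
  rewrite special_comb_rshift vd -[X in _ < X%:~R](subrK 1) -yd.
  exact: floorD1_gt.
Qed.

Lemma sum_avec_lt : \sum_(i < r + J + K + r | (i < J + r)%N) avec R c d i =
  row_mx (const_mx 1) 0.
Proof.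
transitivity (\sum_(i < r + J + K + r) (i < J + r)%N%:R *: avec R c d i).
  rewrite big_mkcond; apply: eq_bigr => i _.
  by case: ifP => _; rewrite ?scale1r ?scale0r.
rewrite sum_avec.
(* The special vectors have indices at least [r + J + K], so none enters the sum. *)
have -> : \row_s (rshift (r + J + K) s < J + r)%N%:R = 0 :> 'rV[R]_r.
  apply/rowP => s; rewrite !mxE; case: ltnP => //=; lia.
rewrite -[X in special_comb X](scale0r 0) special_combZ scale0r addr0.
apply/rowP => i; rewrite mxE; case: (split_ordP i) => [i' ->|k ->].
  by rewrite row_mxEl mxE/= (addnC J) ltn_ord.
rewrite row_mxEr mxE/=; case: ltnP => //=; lia.
Qed.

End Polytope.

(** * Nonzero forms and the two equivalences *)

Lemma linear_form_const1_gt0 (R : realType) (n : nat) (a : 'I_n -> nat) :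
  linear_form a <> (fun _ : 'rV[R]_n => 0) ->
  0 < linear_form a (const_mx 1 : 'rV[R]_n).
Proof.
move=> a_neq0; rewrite lt_neqAle linear_form_ge0 ?andbT; last first.
  by move=> s; rewrite mxE.
apply/eqP => /esym; rewrite linear_form_const1 => /eqP.
rewrite pnatr_eq0 sum_nat_eq0 => /forallP a0; apply: a_neq0.
apply/funext => x; rewrite /linear_form big1// => s _.
by have /eqP-> := a0 s; rewrite mul0r.
Qed.

Theorem theorem1p12 (R : realType) (r J K : nat)
    (c : 'I_J -> 'I_r -> nat) (d : 'I_K -> 'I_r -> nat)
    (r_gt0 : (0 < r)%N) (J_gt0 : (0 < J)%N) (K_gt0 : (0 < K)%N)
    (C_neq0 : forall j, linear_form (c j) <> (fun _ : 'rV[R]_r => 0))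
    (D_neq0 : forall k, linear_form (d k) <> (fun _ : 'rV[R]_r => 0))
    (C_neqD : forall j k,
      (linear_form (c j) : 'rV[R]_r -> R) <> linear_form (d k))
    (cd_neq0 : forall s, (exists j, c j s <> 0%N) \/ (exists k, d k s <> 0%N))
    (cd_sum : forall s, (\sum_(j < J) c j s = \sum_(k < K) d k s)%N) :
  ((forall x : 'rV[R]_r, half_open_cube x -> 0 <= Phi c d x)
   <-> interior_lattice_points (dilate (J + r)%:R (DeltaA R c d)) = set0)
  /\
  ((forall x : 'rV[R]_r, calD R c d x -> 1 <= Phi c d x)
   <-> interior_lattice_points (dilate (J + r + 1)%:R (DeltaA R c d))
       = [set \sum_(i < (r + J + K) + r | (i < J + r)%N) avec R c d i]).
Proof.
have n_gt0 : (0 < r + J + K)%N by lia.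
have D_gt0 k := linear_form_const1_gt0 (D_neq0 k).
have cube0 : half_open_cube (0 : 'rV[R]_r) by move=> s; rewrite mxE lexx ltr01.
have floor_sum_ge0 (y : 'rV[R]_r) : (forall s, 0 < y 0 s) ->
    0 <= \sum_s Num.floor (y 0 s).
  by move=> y0; apply: sumr_ge0 => s _; rewrite floor_ge0 ltW.
split; split.
(* An interior lattice point would have height both at least and less than [J + r]. *)
- move=> Phi_ge0; apply/seteqP; split => // v [].
  rewrite interior_dilate_DeltaA// ?ltr0n ?addn_gt0 ?J_gt0// => -[y [y0 yv hv]] vZ.
  have := le_lt_trans (height_ge_Phi vZ yv) hv.
  rewrite -[(J + r)%:R]/((J + r)%:Z%:~R) ltr_int.
  have := Phi_ge0 _ (frac_half_open_cube y); rewrite PhiDz// => Py.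
  have := floor_sum_ge0 _ y0; lia.
(* If [Phi] is negative at [x], the floor point of [x] has height below [J + r] and so is
   interior. *)
- move=> no_pt x x01; rewrite leNgt; apply/negP => Px.
  have [vZ hv [y y0 yv]] := floor_point_interior c D_gt0 x01.
  suff : (set0 : set 'rV[R]_(r + J + K)) (floor_point c d x) by [].
  rewrite -no_pt; split => //.
  rewrite interior_dilate_DeltaA// ?ltr0n ?addn_gt0 ?J_gt0//.
  exists y; split => //; rewrite hv.
  rewrite -[(J + r)%:R]/((J + r)%:Z%:~R) ltr_int; lia.
- move=> Phi_ge1; rewrite sum_avec_lt.
  have Phi_ge0 (x : 'rV[R]_r) : half_open_cube x -> 0 <= Phi c d x.
    move=> x01; have [/Phi_ge1|/Phi_eq0->//] := pselect (calD R c d x); lia.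
  have [wZ hw [u u_gt0 uw]] := floor_point_interior c D_gt0 cube0.
  rewrite Phi0 add0r floor_point0 in hw; rewrite floor_point0 in wZ uw.
  have zE : ((J + r + 1)%:R : R) = (J + r + 1)%:Z%:~R by [].
  apply/seteqP; split => [v [] | _ ->].
    rewrite interior_dilate_DeltaA// ?ltr0n ?addn_gt0 ?J_gt0//.
    move=> [y [y0 yv hv]] vZ.
    have y0W s : 0 <= y 0 s by exact: ltW.
    have := le_lt_trans (height_ge_Phi vZ yv) hv; rewrite zE ltr_int => Phi_lt.
    have := Phi_ge0 _ (frac_half_open_cube y); rewrite PhiDz// => Py.
    have Fy := floor_sum_ge0 _ y0.
    (* Two nonnegative integers, this sum and [Phi c d y], add up to less than [1]. So both vanish,
       which puts [y] in the cube and outside [calD]. *)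
    have Fy0 : \sum_s Num.floor (y 0 s) = 0 by lia.
    have y01 : half_open_cube y.
      move=> s; rewrite y0W/= -floor_le0.
      move: Fy0 => /eqP; rewrite psumr_eq0; last first.
        by move=> t _; rewrite floor_ge0.
      by move=> /allP/(_ s (mem_index_enum s))/eqP->.
    have yD : ~ calD R c d y by move=> /Phi_ge1; lia.
    (* In the first two blocks the integer [v 0 i] exceeds a nonnegative number; in the last it
       exceeds [- D_k y], which is above [-1] outside [calD]. *)
    have w_le i : (row_mx (const_mx 1) 0 : 'rV[R]_(r + J + K)) 0 i <= v 0 i.
      have /intrP[m vm] := vZ i; move: (yv i); rewrite vm.
      case: (split_ordP i) => [i' ->|k ->].
        have : 0 <= special_comb c d y 0 (lshift K i').
          case: (split_ordP i') => [s ->|j ->].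
            by rewrite special_comb_lshift.
          by rewrite special_comb_mid linear_form_ge0.
        move=> /le_lt_trans/[apply]; rewrite ltr0z row_mxEl mxE.
        by rewrite ler1z gtz0_ge1.
      rewrite special_comb_rshift row_mxEr mxE ler0z => lem.
      have : - 1 < m%:~R :> R.
        apply: lt_trans lem; rewrite ltrN2 ltNge; apply/negP => le1.
        by apply: yD; split => //; right; exists k.
      by rewrite -[- 1]/((-1)%:~R) ltr_int; lia.
    (* The height of [v] is an integer below [J + r + 1], hence at most that of the candidate. As
       [v] dominates the candidate in each coordinate, they coincide. *)
    have hZ : height v \is a Num.int by exact: rpred_sum.
    have hvw : height v <= height (row_mx (const_mx 1) 0 : 'rV[R]_(r + J + K)).
      have /intrP[m vm] := hZ.
      by move: hv; rewrite vm hw zE ltr_int ler_int; lia.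
    apply/rowP => i; apply/eqP; rewrite -subr_eq0.
    have : \sum_i (v 0 i - (row_mx (const_mx 1) 0 : 'rV[R]_(r + J + K)) 0 i) == 0.
      rewrite eq_le sumrB subr_le0 hvw/= -sumrB; apply: sumr_ge0 => j _.
      by rewrite subr_ge0.
    rewrite psumr_eq0 => [|j _]; last by rewrite subr_ge0.
    by move=> /allP/(_ i (mem_index_enum i)).
  split => //; rewrite interior_dilate_DeltaA// ?ltr0n ?addn_gt0 ?J_gt0//.
  by exists u; split => //; rewrite hw zE ltr_int; lia.
- rewrite sum_avec_lt => uniq_pt x [x01 xD]; rewrite leNgt; apply/negP => Px.
  have [vZ hv [y y0 yv]] := floor_point_interior c D_gt0 x01.
  (* Equality with the candidate would make the floors of all [C_j x] and [D_k x] zero,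
     contradicting that [x] lies in [calD]. *)
  suff : [set (row_mx (const_mx 1) 0 : 'rV[R]_(r + J + K))] (floor_point c d x).
    move=> /= /rowP wE; case: xD => [[j]|[k]].
      have := wE (lshift K (rshift r j)).
      rewrite /floor_point !row_mxEl row_mxEr !mxE -[1 in RHS]/(1%:~R).
      by move=> /intr_inj; rewrite -floor_gt0; lia.
    have := wE (rshift (r + J) k).
    rewrite /floor_point !row_mxEr !mxE -[0 in RHS]/(0%:~R).
    by move=> /intr_inj; rewrite -floor_gt0; lia.
  rewrite -uniq_pt; split => //.
  rewrite interior_dilate_DeltaA// ?ltr0n ?addn_gt0 ?J_gt0//.
  exists y; split => //; rewrite hv.
  rewrite -[(J + r + 1)%:R]/((J + r + 1)%:Z%:~R) ltr_int; lia.
Qed.
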